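(* Let $\{X_N\}_N$ and $\{Y_N\}_N$ be independent ensembles of GOE random matrices (for each $N$, $X_N$ and $Y_N$ are independent $N\times N$ GOE matrices). Then $\{X_N\}_N$ and $\{Y_N\}_N$ are not asymptotically infinitesimally free.
   Context: GOE: an $N\times N$ GOE matrix is $\frac{1}{\sqrt{2N}}(G+G^{t})$ where $G=(g_{ij})_{i,j=1}^N$ has independent identically distributed real $\mathcal{N}(0,1)$ entries. $\mathrm{tr}=\frac1N\mathrm{Tr}$. An infinitesimal probability space $(\mathcal{A},\varphi,\varphi')$ is a unital algebra $\mathcal{A}$ over $\mathbb{C}$ with linear functionals $\varphi,\varphi':\mathcal{A}\to\mathbb{C}$, $\varphi(1)=1$, $\varphi'(1)=0$. Unital subalgebras $\mathcal{A}_1,\dots,\mathcal{A}_s$ are infinitesimally free if for all $n\ge 1$ and all $a_1,\dots,a_n$ with $a_i\in\mathcal{A}_{j_i}$, $j_1\ne j_2\neq\cdots\ne j_n$ (neighbouring indices distinct) and $\varphi(a_i)=0$ for all $i$: (1) $\varphi(a_1\cdots a_n)=0$; (2) $\varphi'(a_1\cdots a_n)=0$ for $n$ even, and for $n=2m+1$ odd $\varphi'(a_1\cdots a_n)=\varphi(a_1a_n)\varphi(a_2a_{n-1})\cdots\varphi(a_ma_{m+2})\,\varphi'(a_{m+1})$. Elements $x_1,\dots,x_s$ are infinitesimally free if the unital algebras they generate are. $\{X_N\}_N$ and $\{Y_N\}_N$ are asymptotically infinitesimally free if there are an infinitesimal probability space $(\mathcal{A},\varphi,\varphi')$ and infinitesimally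 free elements $x,y\in\mathcal{A}$ such that for every polynomial $p$ in two non-commuting variables $$\lim_N\mathrm{E}(\mathrm{tr}(p(X_N,Y_N)))=\varphi(p(x,y)),\qquad \lim_N N\big(\mathrm{E}(\mathrm{tr}(p(X_N,Y_N)))-\varphi(p(x,y))\big)=\varphi'(p(x,y)).$$ *)

(* Defs.v *)
From HB Require Import structures.
From mathcomp Require Import all_boot all_order all_algebra.
(* [monalg] has to be imported before MathComp-Analysis: in the other order
   their notations clash. *)
From mathcomp Require Import finmap monalg.
From mathcomp Require Import complex.
From mathcomp Require Import all_classical all_reals all_analysis.

Set Implicit Arguments.
Unset Strict Implicit.
Unset Printing Implicit Defensive.

Import Order.TTheory GRing.Theory Num.Theory.
Import numFieldNormedType.Exports.

Local Open Scope classical_set_scope.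
Local Open Scope ring_scope.

Section RandomMatrices.
Context {R : realType} {d : measure_display} {T : measurableType d}.
Variable P : probability T R.

Definition mutually_independent (I : finType) (X : I -> T -> R) : Prop :=
  forall (J : {set I}) (B : I -> set R), (forall i, measurable (B i)) ->
    P (\bigcap_(i in [set` J]) (X i @^-1` B i)) =
    (\prod_(i in J) P (X i @^-1` B i))%E.

(* Equality of laws is tested on Borel sets only: [distribution] and
   [normal_prob] are total functions on [set R]. *)
Definition std_normal (X : {RV P >-> R}) : Prop :=
  forall B : set R, measurable B ->
    distribution P X B = normal_prob (0 : R) (1 : R) B.

Definition is_GOE (N : nat) (X : T -> 'M[R]_N) : Prop :=
  exists G : 'I_N * 'I_N -> {RV P >-> R},
    [/\ mutually_independent (fun ij => G ij : T -> R),
        forall ij, std_normal (G ij)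
      & forall w, let Gw := \matrix_(i, j) G (i, j) w in
          X w = (Num.sqrt (2 * N)%:R)^-1 *: (Gw + Gw^T)].

Definition sigma_mx (N : nat) (X : T -> 'M[R]_N) : set (set T) :=
  <<s \bigcup_(ij in [set: 'I_N * 'I_N])
        preimage_set_system setT (fun w => X w ij.1 ij.2) measurable >>.

Definition independent_mx (N : nat) (X Y : T -> 'M[R]_N) : Prop :=
  forall A B, sigma_mx X A -> sigma_mx Y B -> P (A `&` B) = (P A * P B)%E.

Definition expectationC (f : T -> R[i]) : R[i] :=
  Complex (fine ('E_P[fun w => complex.Re (f w)])%E)
          (fine ('E_P[fun w => complex.Im (f w)])%E).

End RandomMatrices.

Record infProbSpace (R : realType) := InfProbSpace {
  ips_alg :> algType R[i];
  ips_phi : {scalar ips_alg};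
  ips_dphi : {scalar ips_alg};
  ips_phi1 : ips_phi 1 = 1;
  ips_dphi1 : ips_dphi 1 = 0
}.

Section InfinitesimalFreeness.
Context {R : realType} (A : infProbSpace R).
Local Notation phi := (@ips_phi R A).
Local Notation dphi := (@ips_dphi R A).

Definition unital_subalgebra (S : set A) : Prop :=
  [/\ S 1,
      forall (c : R[i]) a, S a -> S (c *: a),
      forall a b, S a -> S b -> S (a + b)
    & forall a b, S a -> S b -> S (a * b)].

Definition gen_subalgebra (x : A) : set A :=
  \bigcap_(S in [set S | unital_subalgebra S /\ S x]) S.

Lemma gen_subalgebra_unital x : unital_subalgebra (gen_subalgebra x).
Proof.
split=> [S [[]]|c a Sa S|a b Sa Sb S|a b Sa Sb S] //.
- by move=> [uS Sx]; case: (uS) => _ SZ _ _; apply: SZ; apply: Sa.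
- by move=> [uS Sx]; case: (uS) => _ _ SD _; apply: SD; [apply: Sa|apply: Sb].
- by move=> [uS Sx]; case: (uS) => _ _ _ SM; apply: SM; [apply: Sa|apply: Sb].
Qed.

(* The elements a_1, ..., a_n of the usual definition are [a 0, ..., a n.-1];
   [S] is meant to be a family of unital subalgebras. *)
Definition inf_free_subalgebras (s : nat) (S : 'I_s -> set A) : Prop :=
  forall (n : nat) (a : nat -> A) (j : nat -> 'I_s),
    (0 < n)%N ->
    (forall i, (i < n)%N -> S (j i) (a i)) ->
    (forall i, (i.+1 < n)%N -> j i <> j i.+1) ->
    (forall i, (i < n)%N -> phi (a i) = 0) ->
    [/\ phi (\prod_(i < n) a i) = 0,
        ~~ odd n -> dphi (\prod_(i < n) a i) = 0
      & forall m, n = m.*2.+1 ->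
          dphi (\prod_(i < n) a i) =
          (\prod_(i < m) phi (a i * a (m.*2 - i)%N)) * dphi (a m)].

Definition inf_free (s : nat) (x : 'I_s -> A) : Prop :=
  inf_free_subalgebras (fun k => gen_subalgebra (x k)).

End InfinitesimalFreeness.

(* The free algebra C<X_0, X_1>: finitely supported families of coefficients
   indexed by words in two letters. *)
Definition ncpoly2 (R : realType) := {malg R[i][{fmonom 'I_2}]}.

(* [c] is the structure map of the C-algebra [B]. It is an argument, and [mmap]
   is not used, because N x N matrices are only a [pzRingType] when N is not
   known to be positive. *)
Definition nceval (R : realType) (B : pzRingType) (c : R[i] -> B)
    (p : ncpoly2 R) (x y : B) : B :=
  \sum_(w <- msupp p) c p@_w * \prod_(k <- (w : seq 'I_2)) tnth [tuple x; y] k.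

Definition nceval_alg (R : realType) (A : algType R[i]) (p : ncpoly2 R)
    (x y : A) : A :=
  nceval (in_alg A) p x y.

Definition nceval_mx (R : realType) (N : nat) (p : ncpoly2 R)
    (X Y : 'M[R]_N) : 'M[R[i]]_N :=
  nceval (@scalar_mx _ N) p (map_mx (real_complex R) X)
    (map_mx (real_complex R) Y).

Section AsymptoticFreeness.
Context {R : realType} {d : nat -> measure_display}.
Context {T : forall N, measurableType (d N)}.
Variable P : forall N, probability (T N) R.
Variables X Y : forall N, T N -> 'M[R]_N.

Definition Etr (p : ncpoly2 R) (N : nat) : (R[i] : numFieldType) :=
  expectationC (P N)
    (fun w => N%:R^-1 * \tr (nceval_mx p (X w) (Y w))).

Definition asymp_inf_free : Prop :=
  exists (A : infProbSpace R) (x y : A),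
    inf_free (tnth [tuple x; y]) /\
    forall p : ncpoly2 R,
      let l : (R[i] : numFieldType) := ips_phi A (nceval_alg p x y) in
      let l' : (R[i] : numFieldType) := ips_dphi A (nceval_alg p x y) in
      Etr p N @[N --> \oo] --> l /\
      N%:R * (Etr p N - l) @[N --> \oo] --> l'.

End AsymptoticFreeness.

(* Main.v *)
Require Import Defs.
From HB Require Import structures.
From mathcomp Require Import all_boot all_order all_algebra.
From mathcomp Require Import monalg.
From mathcomp Require Import complex.
From mathcomp Require Import all_classical all_reals all_analysis.
From mathcomp Require Import measurable_realfun ring lra.

Import Order.TTheory GRing.Theory Num.Theory.
Import numFieldNormedType.Exports.

Set Implicit Arguments.
Unset Strict Implicit.
Unset Printing Implicit Defensive.

Local Open Scope classical_set_scope.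
Local Open Scope ring_scope.

(* Infinitesimal freeness at the word [xyxy] forces [phi (x y x y) = 0] and
   [dphi (x y x y) = 0], since [phi x = phi y = 0]. On the matrix side
   [N E(tr(X Y X Y))] is the sum over [i, j, k, l] of
   [E(X_ij X_kl) E(Y_jk Y_li)]. Every summand is nonnegative, and the N^2 terms
   with [(k, l) = (i, j)] are each at least [(s2 / N)^2], where [s2] is the
   second moment of the standard normal law. The sum therefore stays above
   [s2^2 > 0] and cannot converge to [dphi (x y x y)]. These lower bounds are
   weaker than the exact value [1 + 3 / N], but they do not require
   the normal moments to be computed. *)

(** * Integrals against the standard normal law *)

(** The Radon-Nikodym derivative and the Gaussian density have the same integral over every
    measurable set, so they agree almost everywhere and can be exchanged under the integral. *)
Lemma ge0_integral_normal_prob (R : realType) (m s : R) (f : R -> \bar R) :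
    measurable_fun [set: R] f -> (forall x, 0 <= f x)%E ->
  (\int[normal_prob m s]_x f x =
   \int[lebesgue_measure]_x (f x * (normal_pdf m s x)%:E))%E.
Proof.
move=> mf f0.
have dom := normal_prob_dominates m s.
rewrite -(Radon_Nikodym_SigmaFinite.change_of_variables dom)//.
have mg := measurable_int _ (Radon_Nikodym_SigmaFinite.f_integrable dom).
have mpdf : measurable_fun [set: R] (EFin \o normal_pdf m s).
  by apply/measurable_EFinP; exact: measurable_normal_pdf.
apply: ae_eq_integral => //.
- exact: emeasurable_funM.
- exact: emeasurable_funM.
have : ae_eq lebesgue_measure setT
    (Radon_Nikodym_SigmaFinite.f (normal_prob m s) lebesgue_measure)
    (EFin \o normal_pdf m s).
  apply: integral_ae_eq => //.
    exact: Radon_Nikodym_SigmaFinite.f_integrable.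
  by move=> E _ mE; rewrite -Radon_Nikodym_SigmaFinite.f_integral.
by apply: filterS => x /= /[apply] ->.
Qed.

(* The bound [t <= expR t] at [t = x ^+ 2 / 4] trades the square for a Gaussian
   of variance 2. *)
Lemma sqr_normal_pdf_le (R : realType) (x : R) :
  x ^+ 2 * normal_pdf 0 1 x <=
  4 * (normal_peak 1 / normal_peak (Num.sqrt 2)) * normal_pdf 0 (Num.sqrt 2) x.
Proof.
have s0 : Num.sqrt 2 != 0 :> R by rewrite gt_eqF// sqrtr_gt0.
have p0 := normal_peak_gt0 s0.
rewrite !normal_pdfE ?oner_eq0//.
rewrite [leRHS](_ : _ =
    normal_peak 1 * (4 * normal_fun 0 (Num.sqrt 2) x)); last first.
  by field; rewrite gt_eqF.
rewrite mulrCA ler_wpM2l ?normal_peak_ge0// /normal_fun !subr0 sqr_sqrtr//.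
have -> : - x ^+ 2 / (1 ^+ 2 *+ 2) = - (x ^+ 2 / 4) - (x ^+ 2 / 4) by field.
have -> : - x ^+ 2 / (2 *+ 2) = - (x ^+ 2 / 4) by field.
set t := x ^+ 2 / 4.
have -> : x ^+ 2 = 4 * t by rewrite /t; field.
rewrite expRD mulrA ler_wpM2r ?expR_ge0// -mulrA ler_piMr//.
rewrite expRN ler_pdivrMr ?expR_gt0// mul1r.
by have := expR_ge1Dx t; lra.
Qed.

Lemma integral_sqr_normal_prob_lty (R : realType) :
  (\int[normal_prob 0 1]_x (x ^+ 2 : R)%:E < +oo)%E.
Proof.
rewrite ge0_integral_normal_prob; last 2 first.
- exact/measurable_EFinP/measurable_funX.
- by move=> x; rewrite lee_fin sqr_ge0.
set C : R := 4 * (normal_peak 1 / normal_peak (Num.sqrt 2)).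
have C0 : 0 <= C by rewrite mulr_ge0// divr_ge0// normal_peak_ge0.
apply: (@le_lt_trans _ _ (\int[lebesgue_measure]_x
    (C%:E * (normal_pdf 0 (Num.sqrt 2) x)%:E))%E).
  apply: ge0_le_integral => //=.
  - by move=> x _; rewrite lee_fin mulr_ge0 ?sqr_ge0 ?normal_pdf_ge0.
  - apply/measurable_EFinP/measurable_funM; first exact: measurable_funX.
    exact: measurable_normal_pdf.
  - apply/measurable_EFinP/measurable_funM => //.
    exact: measurable_normal_pdf.
  - by move=> x _; rewrite lee_fin; exact: sqr_normal_pdf_le.
rewrite ge0_integralZl//.
- by rewrite integral_normal_pdf mule1 ltry.
- by apply/measurable_EFinP; exact: measurable_normal_pdf.
- by move=> x _; rewrite lee_fin normal_pdf_ge0.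
Qed.

(** If the integral were 0, then [x ^+ 2] would vanish off a null set [N]. Then [N] together with
    the null set {0} would cover the line, which has mass 1. *)
Lemma integral_sqr_normal_prob_gt0 (R : realType) :
  (0 < \int[normal_prob 0 1]_x (x ^+ 2 : R)%:E)%E.
Proof.
have m2 : measurable_fun [set: R] (fun x : R => (x ^+ 2)%:E).
  exact/measurable_EFinP/measurable_funX.
rewrite lt0e integral_ge0 ?andbT; last by move=> x _; rewrite lee_fin sqr_ge0.
apply/eqP => E0.
have : ae_eq (normal_prob (0 : R) 1) setT (fun x : R => (x ^+ 2)%:E) (cst 0%E).
  apply/ae_eq_integral_abs => //=; rewrite -[RHS]E0.
  by apply: eq_integral => x _; rewrite /= ger0_norm ?sqr_ge0.
case=> N [mN N0 sub].
have N00 : (normal_prob (0 : R) 1 [set 0%R] = 0)%E by exact: integral_set1.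
have : (normal_prob (0 : R) 1 (N `|` [set 0%R]) <=
        normal_prob (0 : R) 1 N + normal_prob (0 : R) 1 [set 0%R])%E.
  exact: measureU2.
rewrite [X in normal_prob _ _ X](_ : _ = setT); last first.
  apply/seteqP; split=> // x _; have [->|x0] := eqVneq x 0; first by right.
  by left; apply: sub => /(_ I)[] /eqP; rewrite sqrf_eq0 (negbTE x0).
by rewrite probability_setT N0 [X in (_ <= _ + X)%E]N00 adde0 lee_fin ler10.
Qed.

(** * Expectation of a product of two independent integrable variables *)

Section independent_product.
Context {R : realType} {d : measure_display} {T : measurableType d}.
Variables (P : probability T R) (U V : T -> R).
Hypotheses (mU : measurable_fun setT U) (mV : measurable_fun setT V).
Hypothesis indepUV : forall A B : set R, measurable A -> measurable B ->
  P (U @^-1` A `&` V @^-1` B) = (P (U @^-1` A) * P (V @^-1` B))%E.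
Hypothesis intU : P.-integrable setT (EFin \o U).
Hypothesis intV : P.-integrable setT (EFin \o V).

Let W (w : T) : R * R := (U w, V w).

Let mW : measurable_fun setT W.
Proof. exact/measurable_fun_pair. Qed.

Let WRV : {RV P >-> (R * R)%type} := mfun_Sub (mem_set mW).

Let URV : {RV P >-> R} := mfun_Sub (mem_set mU).
Let VRV : {RV P >-> R} := mfun_Sub (mem_set mV).
Let PU := distribution P URV.
Let PV := distribution P VRV.

(** Independence gives the equality on rectangles, and these determine the product measure. *)
Let joint_distribution (A : set (R * R)) : measurable A ->
  (PU \x PV)%E A = distribution P WRV A.
Proof.
apply: product_measure_unique => B C mB mC.
exact: indepUV.
Qed.

Let integrable_id (X : {RV P >-> R}) : P.-integrable setT (EFin \o X) ->
  (distribution P X).-integrable setT EFin.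
Proof. by move=> iX; apply: integrable_pushforward. Qed.

Let mprod : measurable_fun setT (fun z : R * R => (z.1 * z.2)%:E).
Proof. exact/measurable_EFinP/measurable_funM. Qed.

(** By Tonelli, the iterated integral of [|x * y|] is the product of the two finite first absolute
    moments. *)
Let integrable_prod : (PU \x PV)%E.-integrable setT
  (fun z : R * R => (z.1 * z.2)%:E).
Proof.
apply/integrable12ltyP => //=.
have /integrableP[_ /= U1] := integrable_id (X := URV) intU.
have /integrableP[_ /= V1] := integrable_id (X := VRV) intV.
under eq_integral => x _.
  under eq_integral do rewrite normrM EFinM.
  rewrite ge0_integralZl//; last exact: measurableT_comp.
  over.
rewrite ge0_integralZr//; last 2 first.
- exact: measurableT_comp.
- by apply: integral_ge0 => y _; rewrite lee_fin normr_ge0.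
by rewrite lte_mul_pinfty// ?ge0_fin_numE// integral_ge0.
Qed.

Lemma integrable_indepM : P.-integrable setT (fun w => (U w * V w)%:E).
Proof.
apply/integrableP; split; first exact/measurable_EFinP/measurable_funM.
have /integrableP[_] := integrable_prod.
rewrite (eq_measure_integral (distribution P WRV)).
  by rewrite ge0_integral_distribution//; exact: measurableT_comp.
by move=> A mA _; exact: joint_distribution.
Qed.

(** Pass to the law of the pair, which is a product measure, and apply Fubini. *)
Let integral_indepM : (\int[P]_w (U w * V w)%R%:E =
  \int[P]_w (U w)%:E * \int[P]_w (V w)%:E)%E.
Proof.
have -> : (\int[P]_w (U w * V w)%R%:E =
    \int[distribution P WRV]_z (z.1 * z.2)%R%:E)%E.
  by rewrite integral_distribution//; exact: integrable_indepM.
rewrite -(eq_measure_integral _ (fun A mA _ => joint_distribution mA)).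
rewrite -integral12_prod_meas1// /fubini_F/=.
have EV : (\int[PV]_y y%:E = \int[P]_w (V w)%:E)%E.
  exact: integral_distribution.
have EU : (\int[PU]_y y%:E = \int[P]_w (U w)%:E)%E.
  exact: integral_distribution.
under eq_integral => x _.
  under eq_integral do rewrite EFinM.
  rewrite integralZl//; last exact: integrable_id.
  (* The inner integral is exposed as a finite real, so that it can leave the outer integral as a
     scalar. *)
  rewrite EV -(fineK (integrable_fin_num _ intV))//.
  over.
rewrite integralZr ?EU//; last exact: integrable_id.
by rewrite fineK// (integrable_fin_num _ intV).
Qed.

Lemma Rintegral_indepM :
  \int[P]_w (U w * V w) = \int[P]_w U w * \int[P]_w V w.
Proof.
by rewrite /Rintegral integral_indepM fineM//; exact: integrable_fin_num.
Qed.

End independent_product.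

(** * Scalar multiples and finite sums of real integrable functions *)

Lemma integrable_EFinZl {R : realType} {d : measure_display}
    {T : measurableType d} (mu : {measure set T -> \bar R}) (r : R)
    (f : T -> R) : mu.-integrable setT (EFin \o f) ->
  mu.-integrable setT (EFin \o (fun x => r * f x)).
Proof. by move=> intf; apply: (@integrableZl _ _ _ mu _ _ r (EFin \o f)). Qed.

Section Rintegral_sum.
Context {R : realType} {d : measure_display} {T : measurableType d}.
Variables (mu : {measure set T -> \bar R}) (I : Type) (F : I -> T -> R).
Hypothesis intF : forall i, mu.-integrable setT (EFin \o F i).

Lemma integrable_EFin_sum (r : seq I) :
  mu.-integrable setT (EFin \o (fun x => \sum_(i <- r) F i x)).
Proof.
rewrite [X in _.-integrable _ X](_ : _ =
    fun x => (\sum_(i <- r) (EFin \o F i) x)%E).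
  exact: integrable_sum.
by apply/funext => x /=; rewrite -sumEFin.
Qed.

Lemma Rintegral_sum (r : seq I) :
  \int[mu]_x (\sum_(i <- r) F i x) = \sum_(i <- r) \int[mu]_x F i x.
Proof.
elim: r => [|i r ih].
  under eq_Rintegral do rewrite big_nil.
  by rewrite big_nil Rintegral_cst// mul0r.
under eq_Rintegral do rewrite big_cons.
by rewrite big_cons RintegralD ?ih//; exact: integrable_EFin_sum.
Qed.

End Rintegral_sum.

(** * Moments of the standard normal law *)

(* [normal_prob] lives on the Borel sets of [R] with the display of
   [lebesgue_measure], which is not convertible to the canonical one. *)
Lemma measurable_borel_id (R : realType) :
  @measurable_fun _ _ (measurableTypeR R) R setT id.
Proof. by move=> _ A mA; rewrite setTI. Qed.

Definition borel_id (R : realType) : {mfun measurableTypeR R >-> R} :=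
  @mfun_Sub _ _ (measurableTypeR R) R id (mem_set (@measurable_borel_id R)).

(** Pushing forward along the identity puts the law on the canonical Borel structure, where it can
    be compared with [distribution P g]. *)
Definition normal_law (R : realType) : probability R R :=
  distribution (normal_prob 0 1) (@borel_id R).

(** The first moment is carried as a symbol: means of entries multiply it by a factor that tends to
    0, and second moments contain only its square. *)
Definition normal_moment (R : realType) (n : nat) : R :=
  \int[normal_law R]_x x ^+ n.

Lemma integral_sqr_normal_law (R : realType) :
  (\int[normal_law R]_x (x ^+ 2)%:E = \int[normal_prob 0 1]_x (x ^+ 2)%:E)%E.
Proof.
rewrite ge0_integral_distribution//.
- exact/measurable_EFinP/measurable_funX.
- by move=> x; rewrite lee_fin sqr_ge0.
Qed.

(** Finiteness matters as much as positivity here, since [fine] sends an infinite integral to 0. *)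
Lemma normal_moment2_gt0 (R : realType) : 0 < normal_moment R 2.
Proof.
rewrite fine_gt0// [X in (_ < X < _)%E]integral_sqr_normal_law.
by rewrite integral_sqr_normal_prob_gt0 integral_sqr_normal_prob_lty.
Qed.

Section std_normal_moments.
Context {R : realType} {d : measure_display} {T : measurableType d}.
Variables (P : probability T R) (g : {RV P >-> R}).
Hypothesis stdg : std_normal g.

Lemma std_normal_integrable_sqr :
  P.-integrable setT (EFin \o (fun w => g w ^+ 2)).
Proof.
apply/integrableP; split; first exact/measurable_EFinP/measurable_funX.
under eq_integral do rewrite /= ger0_norm ?sqr_ge0//.
have mx2 : measurable_fun setT (fun x : R => (x ^+ 2)%:E).
  exact/measurable_EFinP/measurable_funX.
rewrite -(ge0_integral_distribution g mx2); last first.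
  by move=> x; rewrite lee_fin sqr_ge0.
rewrite (eq_measure_integral (normal_law R)).
  by rewrite integral_sqr_normal_law integral_sqr_normal_prob_lty.
by move=> A mA _; exact: stdg.
Qed.

Lemma std_normal_integrable : P.-integrable setT (EFin \o g).
Proof.
apply: (@le_integrable _ _ _ P setT _ _
  (EFin \o (fun w => 1 + g w ^+ 2))) => //.
- exact/measurable_EFinP.
- move=> w _; rewrite lee_fin [leRHS]ger0_norm ?addr_ge0 ?sqr_ge0//.
  (* With [t = |g w|] this is [t <= 1 + t ^+ 2]. *)
  by rewrite -[g w ^+ 2]real_normK ?num_real//; nra.
- have -> : EFin \o (fun w => 1 + g w ^+ 2) =
      ((EFin \o cst 1%R) \+ (EFin \o (fun w => (g w ^+ 2)%R)))%E by [].
  apply: integrableD => //; last exact: std_normal_integrable_sqr.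
  exact: finite_measure_integrable_cst.
Qed.

Lemma std_normal_moment (n : nat) :
    P.-integrable setT (EFin \o (fun w => g w ^+ n)) ->
  \int[P]_w g w ^+ n = normal_moment R n.
Proof.
move=> ign; rewrite /normal_moment /Rintegral.
have mxn : measurable_fun setT (fun x : R => (x ^+ n)%:E).
  exact/measurable_EFinP/measurable_funX.
rewrite -(integral_distribution mxn)//.
congr fine; apply: eq_measure_integral => A mA _; exact: stdg.
Qed.

End std_normal_moments.

(** * First and second moments of GOE entries *)

Section GOE_moments.
Context {R : realType} {d : measure_display} {T : measurableType d}.
Variables (P : probability T R).

Lemma mutually_independent2 (I : finType) (G : I -> T -> R) (a b : I)
    (A B : set R) : mutually_independent P G -> a != b ->
    measurable A -> measurable B ->
  P (G a @^-1` A `&` G b @^-1` B) = (P (G a @^-1` A) * P (G b @^-1` B))%E.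
Proof.
move=> indG ab mA mB.
have ba : (b == a) = false by rewrite eq_sym (negbTE ab).
(* The family of Borel sets is [A] at [a] and [B] at every other index; the index set {a, b} sees
   only these two. *)
have := indG [set a; b]%SET (fun i => if i == a then A else B).
rewrite big_setU1 ?inE// big_set1 eqxx ba => <-; last by move=> i; case: ifP.
congr (P _); apply/seteqP; split=> [w [Aw Bw] i /=|w Gw]; last first.
  split; first by have /= := Gw a; rewrite !inE !eqxx; exact.
  by have /= := Gw b; rewrite !inE eqxx orbT ba; exact.
by rewrite !inE => /orP[]/eqP ->; rewrite ?eqxx ?ba.
Qed.

Variables (N : nat) (X : T -> 'M[R]_N).
Hypothesis goeX : is_GOE P X.

(** Summing over the list of [(i, j)] and [(j, i)] treats all entries alike: on the diagonal the
    list repeats one index and gives twice the same Gaussian. *)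
Lemma GOE_entryP : exists2 G : 'I_N * 'I_N -> {RV P >-> R},
    forall w i j, X w i j =
      (Num.sqrt (2 * N)%:R)^-1 * (\sum_(a <- [:: (i, j); (j, i)]) G a w)
  & (forall a, std_normal (G a)) /\
    (forall a b,
      P.-integrable setT (EFin \o (fun w => G a w * G b w)) /\
      \int[P]_w (G a w * G b w) =
        if a == b then normal_moment R 2 else normal_moment R 1 ^+ 2).
Proof.
have [G [indG stdG XE]] := goeX; exists G.
  by move=> w i j; rewrite XE !mxE big_cons big_seq1.
split=> // a b; have [<-|ab] := eqVneq.
  split; first exact: std_normal_integrable_sqr.
  rewrite -(std_normal_moment (stdG a)) //; exact: std_normal_integrable_sqr.
have intG c := std_normal_integrable (stdG c).
have meanG c : \int[P]_w G c w = normal_moment R 1.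
  exact: (std_normal_moment (stdG c) (n := 1) (intG c)).
have ind := @mutually_independent2 _ _ a b _ _ indG ab.
split; first exact: integrable_indepM.
by rewrite Rintegral_indepM// !meanG.
Qed.

Lemma GOE_entry_measurable i j : measurable_fun setT (fun w => X w i j).
Proof.
have [G XE _] := GOE_entryP; under eq_fun do rewrite XE.
by apply: measurable_funM => //; exact: measurable_sum.
Qed.

Lemma GOE_entry_mean i j :
  P.-integrable setT (EFin \o (fun w => X w i j)) /\
  \int[P]_w X w i j = (Num.sqrt (2 * N)%:R)^-1 * (2 * normal_moment R 1).
Proof.
have [G XE [stdG _]] := GOE_entryP.
have intG c := std_normal_integrable (stdG c).
have intS := integrable_EFin_sum intG [:: (i, j); (j, i)].
split.
  by under eq_fun do rewrite XE; exact: integrable_EFinZl.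
under eq_Rintegral do rewrite XE.
rewrite RintegralZl// Rintegral_sum// big_cons big_seq1.
have meanG c : \int[P]_w G c w = normal_moment R 1.
  exact: (std_normal_moment (stdG c) (n := 1) (intG c)).
by rewrite !meanG; congr (_ * _); ring.
Qed.

Lemma GOE_tr : (0 < N)%N ->
  \int[P]_w (N%:R^-1 * \tr (X w)) =
  (Num.sqrt (2 * N)%:R)^-1 * (2 * normal_moment R 1).
Proof.
move=> N0; have intX i := (GOE_entry_mean i i).1.
rewrite RintegralZl//; last exact: integrable_EFin_sum.
rewrite Rintegral_sum// (eq_bigr _ (fun i _ => (GOE_entry_mean i i).2)).
by rewrite sumr_const card_ord -[X in _ * X]mulr_natl mulKf// pnatr_eq0 -lt0n.
Qed.

(** Expanding both entries leaves four products of Gaussians, each contributing a second moment or a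
    squared mean according to whether the indices coincide. *)
Lemma GOE_entryM i j k l :
  P.-integrable setT (EFin \o (fun w => X w i j * X w k l)) /\
  \int[P]_w (X w i j * X w k l) = (2 * N)%:R^-1 *
    \sum_(a <- [:: (i, j); (j, i)]) \sum_(b <- [:: (k, l); (l, k)])
      if a == b then normal_moment R 2 else normal_moment R 1 ^+ 2.
Proof.
have [G XE [_ GG]] := GOE_entryP.
have XXE w : X w i j * X w k l = (2 * N)%:R^-1 *
    \sum_(a <- [:: (i, j); (j, i)]) \sum_(b <- [:: (k, l); (l, k)])
      (G a w * G b w).
  rewrite !XE mulrACA -invfM -expr2 sqr_sqrtr// mulr_suml.
  by congr (_ * _); apply: eq_bigr => a _; rewrite mulr_sumr.
have intGG a := integrable_EFin_sum (fun b => (GG a b).1) [:: (k, l); (l, k)].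
split.
  under eq_fun do rewrite XXE.
  exact/integrable_EFinZl/integrable_EFin_sum.
under eq_Rintegral do rewrite XXE.
rewrite RintegralZl//; last exact: integrable_EFin_sum.
congr (_ * _); rewrite Rintegral_sum//; apply: eq_bigr => a _.
rewrite Rintegral_sum; last by move=> b; exact: (GG a b).1.
by apply: eq_bigr => b _; exact: (GG a b).2.
Qed.

Lemma GOE_entryM_ge0 i j k l : 0 <= \int[P]_w (X w i j * X w k l).
Proof.
rewrite (GOE_entryM i j k l).2 mulr_ge0 ?invr_ge0//.
apply: sumr_ge0 => a _; apply: sumr_ge0 => b _.
by case: ifP => _; rewrite ?sqr_ge0 ?ltW ?normal_moment2_gt0.
Qed.

Lemma GOE_entry_sqr_ge i j :
  normal_moment R 2 / N%:R <= \int[P]_w (X w i j * X w i j).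
Proof.
have N0 : N%:R != 0 :> R.
  by rewrite pnatr_eq0 -lt0n (leq_ltn_trans _ (ltn_ord i)).
rewrite (GOE_entryM i j i j).2 !big_cons !big_nil !addr0 !eqxx.
have m2 := ltW (normal_moment2_gt0 R); have m1 := sqr_ge0 (normal_moment R 1).
(* Of the four terms, the two with equal list positions give the second moment each; the other two
   are nonnegative and are dropped. *)
rewrite [leLHS](_ : _ =
    (2 * N)%:R^-1 * (normal_moment R 2 + normal_moment R 2)).
  rewrite ler_wpM2l ?invr_ge0// lerD//.
    by case: ifP => _; rewrite lerDl.
  by case: ifP => _; rewrite lerDr.
by rewrite natrM; field.
Qed.

End GOE_moments.

(** * Lower bound for the expected trace of XYXY *)

(** With [p = ((i, j), (k, l))], the entries of [A] and of [B] are grouped apart, ready for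
    factoring by independence. *)
Lemma mxtrace_mul4 (R : comPzRingType) (N : nat) (A B : 'M[R]_N) :
  \tr (A *m B *m A *m B) =
  \sum_(p : 'I_N * 'I_N * ('I_N * 'I_N))
    (A p.1.1 p.1.2 * A p.2.1 p.2.2) * (B p.1.2 p.2.1 * B p.2.2 p.1.1).
Proof.
rewrite -(pair_bigA _ (fun p q =>
  A p.1 p.2 * A q.1 q.2 * (B p.2 q.1 * B q.2 p.1))).
rewrite -(pair_bigA _ (fun i j => \sum_(q : 'I_N * 'I_N)
  A i j * A q.1 q.2 * (B j q.1 * B q.2 i)))/=.
apply: eq_bigr => i _.
under [RHS]eq_bigr => j _.
  rewrite -(pair_bigA _ (fun k l => A i j * A k l * (B j k * B l i)))/=.
  over.
(* The sums over j, k, l are reordered as l, k, j, the order in which the left-nested matrix product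
   unfolds. *)
rewrite mxE [RHS]exchange_big/=.
under [RHS]eq_bigr do rewrite exchange_big/=.
rewrite [RHS]exchange_big/=; apply: eq_bigr => l _.
rewrite mxE mulr_suml; apply: eq_bigr => k _.
rewrite mxE !mulr_suml; apply: eq_bigr => j _.
by ring.
Qed.

Section independent_GOE.
Context {R : realType} {d : measure_display} {T : measurableType d}.
Variables (P : probability T R) (N : nat) (X Y : T -> 'M[R]_N).

(** Equip [T] with the sigma-algebra generated by the entries of [Z]: each entry is measurable by
    construction, hence so are products. *)
Lemma sigma_mx_entryM (Z : T -> 'M[R]_N) i j k l (A : set R) : measurable A ->
  sigma_mx Z ((fun w => Z w i j * Z w k l) @^-1` A).
Proof.
move=> mA.
pose S := \bigcup_(ij in [set: 'I_N * 'I_N])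
  preimage_set_system setT (fun w => Z w ij.1 ij.2) (measurable : set (set R)).
have mZ p q : @measurable_fun _ _ (g_sigma_algebraType S) R setT
    (fun w => Z w p q).
  move=> _ B mB; apply: sub_sigma_algebra.
  by exists (p, q) => //; exists B.
have : @measurable_fun _ _ (g_sigma_algebraType S) R setT
    (fun w => Z w i j * Z w k l) by exact: measurable_funM.
by move=> /(_ measurableT A mA); rewrite setTI.
Qed.

Hypotheses (goeX : is_GOE P X) (goeY : is_GOE P Y).
Hypothesis indXY : independent_mx P X Y.

Let s2 := normal_moment R 2.

Lemma GOE_tr_mul4 : (0 < N)%N ->
  P.-integrable setT (EFin \o (fun w => \tr (X w *m Y w *m X w *m Y w))) /\
  s2 ^+ 2 <= \int[P]_w \tr (X w *m Y w *m X w *m Y w).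
Proof.
move=> N0.
pose U (p : 'I_N * 'I_N * ('I_N * 'I_N)) w := X w p.1.1 p.1.2 * X w p.2.1 p.2.2.
pose V (p : 'I_N * 'I_N * ('I_N * 'I_N)) w := Y w p.1.2 p.2.1 * Y w p.2.2 p.1.1.
have iU p := (GOE_entryM goeX p.1.1 p.1.2 p.2.1 p.2.2).1.
have iV p := (GOE_entryM goeY p.1.2 p.2.1 p.2.2 p.1.1).1.
have mU p : measurable_fun setT (U p).
  by apply: measurable_funM; exact: GOE_entry_measurable goeX _ _.
have mV p : measurable_fun setT (V p).
  by apply: measurable_funM; exact: GOE_entry_measurable goeY _ _.
have iUV p (A B : set R) : measurable A -> measurable B ->
    P (U p @^-1` A `&` V p @^-1` B) = (P (U p @^-1` A) * P (V p @^-1` B))%E.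
  by move=> mA mB; apply: indXY; exact: sigma_mx_entryM.
have intUV p := integrable_indepM (mU p) (mV p) (iUV p) (iU p) (iV p).
split.
  by under eq_fun do rewrite mxtrace_mul4; exact: integrable_EFin_sum.
under eq_Rintegral do rewrite mxtrace_mul4.
rewrite Rintegral_sum => [|p]; last exact: intUV.
rewrite (eq_bigr (fun p => \int[P]_w U p w * \int[P]_w V p w)); last first.
  by move=> p _; exact: (Rintegral_indepM (mU p) (mV p) (iUV p) (iU p) (iV p)).
have UV0 p : 0 <= \int[P]_w U p w * \int[P]_w V p w.
  rewrite mulr_ge0//; first exact: GOE_entryM_ge0 goeX _ _ _ _.
  exact: GOE_entryM_ge0 goeY _ _ _ _.
rewrite -(pair_bigA _ (fun p q =>
  \int[P]_w U (p, q) w * \int[P]_w V (p, q) w))/=.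
(* There are N^2 pairs, so this intermediate sum is exactly [s2 ^+ 2]. *)
apply: (@le_trans _ _ (\sum_(p : 'I_N * 'I_N) (s2 / N%:R) ^+ 2)).
  rewrite sumr_const card_prod card_ord -[leRHS]mulr_natl natrM expr_div_n.
  by rewrite -expr2 mulrCA divff ?mulr1// expf_neq0// pnatr_eq0 -lt0n.
(* Only [q = p] is kept: for [p = (i, j)] the factors there are the expectations of the squares of
   [X_ij] and [Y_ji]. *)
apply: ler_sum => p _; rewrite (bigD1 p)//=.
rewrite -[leLHS]addr0 lerD//; last by apply: sumr_ge0 => q _; exact: UV0 (p, q).
have s20 : 0 <= s2 / N%:R by rewrite divr_ge0// ltW// normal_moment2_gt0.
rewrite expr2 ler_pM//; first exact: GOE_entry_sqr_ge goeX _ _.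
exact: GOE_entry_sqr_ge goeY _ _.
Qed.

End independent_GOE.

(** * Words in the free algebra and their expected traces *)

Section word_moments.
Context {R : realType}.

Definition word (s : seq 'I_2) : ncpoly2 R := << FMonom s >>.

Lemma nceval_word (B : pzRingType) (c : R[i] -> B) s (x y : B) : c 1 = 1 ->
  nceval c (word s) x y = \prod_(k <- s) tnth [tuple x; y] k.
Proof.
move=> c1; rewrite /nceval msuppU1 finmap.big_seq_fset1.
by rewrite mcoeffU1 eqxx c1 mul1r.
Qed.

Lemma nceval_alg_word (A : algType R[i]) s (x y : A) :
  nceval_alg (word s) x y = \prod_(k <- s) tnth [tuple x; y] k.
Proof. by apply: nceval_word; rewrite /= scale1r. Qed.

Lemma nceval_mx_word N s (A B : 'M[R]_N) :
  nceval_mx (word s) A B =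
  map_mx (real_complex R) (\prod_(k <- s) tnth [tuple A; B] k).
Proof.
rewrite /nceval_mx nceval_word// rmorph_prod; apply: eq_bigr => k _.
by case: k => -[|[|]].
Qed.

Context {d : nat -> measure_display} {T : forall N, measurableType (d N)}.
Variable P : forall N, probability (T N) R.
Variables X Y : forall N, T N -> 'M[R]_N.

(** The trace of a word in real matrices is real, so the imaginary part of the expectation
    integrates to 0. *)
Lemma Etr_word s N : Etr P X Y (word s) N = real_complex R
  (\int[P N]_w (N%:R^-1 * \tr (\prod_(k <- s) tnth [tuple X w; Y w] k))).
Proof.
have trE w : N%:R^-1 * \tr (nceval_mx (word s) (X w) (Y w)) = real_complex R
    (N%:R^-1 * \tr (\prod_(k <- s) tnth [tuple X w; Y w] k)).
  by rewrite nceval_mx_word trace_map_mx rmorphM fmorphV rmorph_nat.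
rewrite /Etr /expectationC unlock.
under eq_integral do rewrite trE.
under [in X in Complex _ X]eq_integral do rewrite trE.
by rewrite /= integral0.
Qed.

End word_moments.

(** * Limits in the complex numbers and the contradiction *)

Lemma normc_real_complex (R : rcfType) (r : R) :
  `|real_complex R r| = real_complex R `|r|.
Proof. by rewrite normc_def/= expr0n addr0 sqrtr_sqr. Qed.

(** The order on [R[i]] compares only numbers with equal imaginary parts. This turns a complex
    tolerance into a real one. *)
Lemma gt0_complexE (R : rcfType) (e : R[i]) :
  0 < e -> exists2 r : R, 0 < r & e = real_complex R r.
Proof. by case: e => a b; rewrite ltcE/= => /andP[/eqP -> ?]; exists a. Qed.

Lemma cvg_GOE_tr (R : realType) (d : nat -> measure_display)
    (T : forall N, measurableType (d N)) (P : forall N, probability (T N) R)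
    (X : forall N, T N -> 'M[R]_N) : (forall N, is_GOE (P N) (X N)) ->
  (real_complex R (\int[P N]_w (N%:R^-1 * \tr (X N w))) : (R[i] : numFieldType))
    @[N --> \oo] --> (0 : (R[i] : numFieldType)).
Proof.
move=> goeX; apply/cvgr0Pnorm_lt => _ /gt0_complexE[e e0 ->].
near=> N.
(* The squared mean is 4 m^2 / (2 N) = 2 m^2 / N, with m the first normal moment; it is below e^2
   from this threshold on. *)
have Nlt : 2 * normal_moment R 1 ^+ 2 / e ^+ 2 < N%:R.
  by near: N; exact: nbhs_infty_gtr.
have N0 : 0 < N%:R :> R.
  apply: le_lt_trans Nlt; rewrite divr_ge0 ?sqr_ge0 // mulr_ge0 //.
  exact: sqr_ge0.
rewrite (GOE_tr (goeX N)); last by rewrite -(ltr0n R).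
rewrite normc_real_complex ltcR.
rewrite -(@ltr_pXn2r _ 2) ?nnegrE ?normr_ge0 ?(ltW e0)//.
rewrite real_normK ?num_real// exprMn exprVn sqr_sqrtr// natrM.
rewrite ltr_pdivrMr ?exprn_gt0// in Nlt.
rewrite mulrC ltr_pdivrMr ?mulr_gt0//.
by move: Nlt; nra.
Unshelve. all: by end_near. Qed.

Lemma prod_word4 (R : pzRingType) (N : nat) (A B : 'M[R]_N) :
  \prod_(k <- [:: 0; 1; 0; 1] : seq 'I_2) tnth [tuple A; B] k =
  A *m B *m A *m B.
Proof. by rewrite !big_cons big_nil mulr1 -!mulmxA. Qed.

Theorem proposition28 (R : realType) (d : nat -> measure_display)
    (T : forall N : nat, measurableType (d N))
    (P : forall N : nat, probability (T N) R)
    (X Y : forall N : nat, T N -> 'M[R]_N)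
    (hX : forall N : nat, is_GOE (P N) (X N))
    (hY : forall N : nat, is_GOE (P N) (Y N))
    (hXY : forall N : nat, independent_mx (P N) (X N) (Y N)) :
  ~ asymp_inf_free P X Y.
Proof.
move=> [A [x [y [free conv]]]].
(* Uniqueness of limits for one-letter words shows that both generators are centred. *)
have phi0 k : ips_phi A (tnth [tuple x; y] k) = 0.
  have [+ _] := conv (word [:: k]); rewrite nceval_alg_word big_seq1 => Zl.
  have Z0 : Etr P X Y (word [:: k]) N @[N --> \oo] -->
      (0 : (R[i] : numFieldType)).
    rewrite (_ : Etr P X Y (word [:: k]) = fun N => real_complex R
        (\int[P N]_w (N%:R^-1 * \tr (tnth [tuple X N w; Y N w] k)))).
      case: k {Zl} => -[|[|]] // ?; first exact: cvg_GOE_tr hX.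
      exact: cvg_GOE_tr hY.
    apply/funext => N; rewrite Etr_word.
    by under eq_Rintegral do rewrite big_seq1.
  rewrite -(cvg_lim (@norm_hausdorff _ _) Zl).
  by rewrite (cvg_lim (@norm_hausdorff _ _) Z0).
(* Alternating indices spell xyxy: neighbours differ and the length is even, so freeness makes both
   functionals vanish on it. *)
pose j (i : nat) : 'I_2 := if odd i then 1 else 0.
have prodE : \prod_(i < 4) tnth [tuple x; y] (j i) =
    nceval_alg (word [:: 0; 1; 0; 1]) x y.
  by rewrite nceval_alg_word !big_ord_recl big_ord0 !big_cons big_nil.
have [] := free 4 (fun i => tnth [tuple x; y] (j i)) j isT.
- by move=> i _ S [].
- by move=> i _; rewrite /j /=; case: (odd i).
- by move=> i _; exact: phi0.
rewrite prodE => phi4 /(_ isT) dphi4 _.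
have [_] := conv (word [:: 0; 1; 0; 1]).
rewrite phi4 dphi4 => /cvgr0Pnorm_lt.
(* The tolerance is the lower bound from [GOE_tr_mul4], which holds at every positive size. *)
move=> /(_ (real_complex R (normal_moment R 2 ^+ 2))).
rewrite ltcR exprn_gt0 ?normal_moment2_gt0// => /(_ isT)[M _ Mlt].
(* The size [M.+1] is past the threshold and nonzero, so the factor N cancels the normalisation of
   the trace. *)
have := Mlt M.+1 (leqnSn M); rewrite /= subr0 Etr_word.
have [int4 ge4] := GOE_tr_mul4 (hX M.+1) (hY M.+1) (hXY M.+1) isT.
under eq_Rintegral do rewrite prod_word4.
rewrite RintegralZl// -(rmorph_nat (real_complex R)) -rmorphM.
rewrite mulVKf ?pnatr_eq0// normc_real_complex ltcR.
by rewrite ltNge (le_trans ge4)// ler_norm.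
Qed.
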